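(* Let $(\mathcal H_n)_{n\in\overline{\mathbb N}}$ be Hilbert spaces and $J_n:\mathcal H_n\to\mathcal H_\infty$ ($n\in\mathbb N$) bounded operators. If there is a parent space with isometries $(\iota_n)_{n\in\overline{\mathbb N}}$ factorising $(J_n)_{n\in\mathbb N}$ such that $P_nP_\infty=P_\infty P_n$ for all $n\in\mathbb N$, where $P_n=\iota_n\iota_n^*$ for $n\in\overline{\mathbb N}$, then this commutation property holds for all parent spaces with isometries factorising $(J_n)_{n\in\mathbb N}$.
   Context: All Hilbert spaces are complex and separable; $\mathbb N=\{1,2,\dots\}$, $\overline{\mathbb N}=\mathbb N\cup\{\infty\}$. A parent space for $(\mathcal H_n)_{n\in\overline{\mathbb N}}$ is a Hilbert space $\mathcal H$ together with isometries $\iota_n:\mathcal H_n\to\mathcal H$ for all $n\in\overline{\mathbb N}$; these isometries factorise $(J_n)_{n\in\mathbb N}$ if $J_n=\iota_\infty^*\iota_n$ for all $n\in\mathbb N$. *)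

(* Defs.v *)
From HB Require Import structures.
From mathcomp Require Import all_boot all_order all_algebra sesquilinear.
From mathcomp Require Import complex ring lra.
From mathcomp Require Import all_classical all_reals all_analysis.

Set Implicit Arguments.
Unset Strict Implicit.
Unset Printing Implicit Defensive.

Import Order.TTheory GRing.Theory Num.Theory.
Import numFieldNormedType.Exports.

Local Open Scope classical_set_scope.
Local Open Scope ring_scope.
Local Open Scope complex_scope.

(* Complex separable Hilbert spaces. The dot product is linear in its first
   argument and conjugate-linear in the second, as everywhere in sesquilinear. *)
HB.mixin Record CompleteNormedModule_isHilbert (R : realType) (V : Type)
    of CompleteNormedModule R[i] V := {
  inner : {dot V for Num.conj};
  innerE : forall x : V, inner x x = `|x| ^+ 2;
  hilbert_separable : exists2 D : set V, countable D & dense D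
}.

#[short(type="hilbertType")]
HB.structure Definition Hilbert (R : realType) :=
  {V of CompleteNormedModule R[i] V & CompleteNormedModule_isHilbert R V}.

Section RealPart.
Variables (R : realType) (H : hilbertType R).
Implicit Types x y z : H.

Local Notation re := (@complex.Re R).

Lemma reD (a b : R[i]) : re (a + b) = re a + re b.
Proof. by case: a b => [? ?] [? ?]. Qed.

Lemma reN (a : R[i]) : re (- a) = - re a.
Proof. by case: a. Qed.

Lemma reZ (a : R) (b : R[i]) : re (a%:C * b) = a * re b.
Proof. by case: b => b c /=; ring. Qed.

Definition rdot x y : R := re (inner x y).

Lemma rdotC x y : rdot x y = rdot y x.
Proof. by rewrite /rdot hermC /= expr0 mul1r; case: (inner y x). Qed.

Lemma rdotDl x y z : rdot (x + y) z = rdot x z + rdot y z.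
Proof. by rewrite /rdot linearDl reD. Qed.

Lemma rdotDr x y z : rdot z (x + y) = rdot z x + rdot z y.
Proof. by rewrite rdotC rdotDl !(rdotC z). Qed.

Lemma rdotNl x z : rdot (- x) z = - rdot x z.
Proof. by rewrite /rdot linearNl reN. Qed.

Lemma rdotNr x z : rdot z (- x) = - rdot z x.
Proof. by rewrite rdotC rdotNl rdotC. Qed.

Lemma innerZl a x y : inner (a *: x) y = a * inner x y.
Proof. by rewrite linearZl_LR. Qed.

Lemma rdotZl (a : R) x y : rdot (a%:C *: x) y = a * rdot x y.
Proof. by rewrite /rdot innerZl reZ. Qed.

Lemma rdotZr (a : R) x y : rdot x (a%:C *: y) = a * rdot x y.
Proof. by rewrite rdotC rdotZl rdotC. Qed.

Lemma rdotE x : (rdot x x)%:C = `|x| ^+ 2.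
Proof. by rewrite /rdot innerE RRe_real // rpredX // normr_real. Qed.

Lemma rdotZ (c : R[i]) x :
  (rdot (c *: x) (c *: x))%:C = `|c| ^+ 2 * (rdot x x)%:C.
Proof. by rewrite !rdotE normrZ exprMn. Qed.

Lemma rdot_ge0 x : 0 <= rdot x x.
Proof. by rewrite -ler0c rdotE exprn_ge0. Qed.

Lemma rdot_norm_lt x (a : R) : 0 < a -> rdot x x < a ^+ 2 -> `|x| < a%:C.
Proof.
move=> a0 xa; rewrite -(@ltr_pXn2r _ 2) ?nnegrE ?ler0c ?(ltW a0) //.
by rewrite -rdotE -rmorphXn ltcR.
Qed.

(* Riesz representation: the representing vector maximises
   x |-> 2 Re (phi x) - |x|^2; phiB is the boundedness of phi in the form that
   makes this supremum finite. *)
Lemma riesz (phi : H -> R[i]) (B : R) :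
  {morph phi : x y / x + y} -> (forall c x, phi (c *: x) = c * phi x) ->
  (forall x, 2 * re (phi x) <= rdot x x + B) ->
  exists v, forall x, phi x = inner x v.
Proof.
move=> phiD phiZ phiB.
pose F x := 2 * re (phi x) - rdot x x.
have FB x : F x <= B by have := phiB x; rewrite /F; lra.
pose s := sup (range F).
have supF : has_sup (range F).
  by split; [exists (F 0); exists 0 | exists B => _ [x _ <-]].
have Fs x : F x <= s by apply: sup_upper_bound => //; exists x.
have FD x w : F (x + w) = F x + 2 * re (phi w) - 2 * rdot w x - rdot w w.
  by rewrite /F phiD reD !(rdotDl, rdotDr) (rdotC x w); ring.
have dist x y : rdot (x - y) (x - y) <= 2 * (2 * s - F x - F y).
  have h := Fs (2^-1 *: (x + y)).
  have e : 2^-1 *: (x + y) + 2^-1 *: (x + y) = x + y.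
    have h2 : 2^-1 + 2^-1 = 1 :> R[i] by field.
    by rewrite -scalerDl h2 scale1r.
  set m := 2^-1 *: (x + y) in h e.
  have hr : 4 * rdot m m = rdot (x + y) (x + y) by rewrite -e rdotDl !rdotDr; ring.
  have hp : 2 * re (phi m) = re (phi x) + re (phi y).
    by have /= := congr1 (re \o phi) e; rewrite !phiD !reD; lra.
  move: h hr hp; rewrite /F !(rdotDl, rdotDr, rdotNl, rdotNr) (rdotC y x); lra.
have /choice[u uP] (n : nat) : exists x, s - n.+1%:R^-1 < F x.
  have [|_ [x _ <-] ltx] := sup_adherent (eps := n.+1%:R^-1) _ supF.
    by rewrite invr_gt0 ltr0n.
  by exists x.
have u_cauchy : cauchy (u @ \oo).
  apply: cauchy_exP => e e0.
  have [d d0 de] : exists2 d : R, 0 < d & d%:C = e.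
    exists (re e); last by rewrite RRe_real // gtr0_real.
    by move: e0; rewrite ltcE => /andP[].
  have d4 : 0 < d ^+ 2 / 4 by rewrite divr_gt0 ?exprn_gt0.
  have [N _ NP] := near_infty_natSinv_lt (PosNum d4).
  exists (u N); exists N => // n /= Nn; rewrite -ball_normE /= -de.
  apply: rdot_norm_lt => //.
  have := dist (u N) (u n).
  have := NP N (leqnn _); have := NP n Nn; have := uP N; have := uP n => /=.
  move: (F (u n)) (F (u N)) (n.+1%:R^-1) (N.+1%:R^-1) (rdot _ _) (s) (d ^+ 2) => *; lra.
have /cvg_ex[v uv] : cvgn u by apply: cauchy_cvg.


have key w : re (phi w) - rdot w v <= rdot w w.
  apply/ler_addgt0Pr => e e0.
  have [N _ NP] := near_infty_natSinv_lt (PosNum e0).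
  have [M _ MP] : \forall n \near \oo, `|v - u n| < (Num.sqrt e)%:C.
    by move/cvgrPdist_lt : uv; apply; rewrite ltcR sqrtr_gt0.
  pose n := maxn N M.
  have h1 : rdot (v - u n) (v - u n) < e.
    have : `|v - u n| ^+ 2 < (Num.sqrt e)%:C ^+ 2.
      by rewrite ltrXn2r // MP //= leq_maxr.
    by rewrite -rdotE -rmorphXn ltcR sqr_sqrtr // ltW.
  have h2 : n.+1%:R^-1 < e by apply: NP; rewrite /= leq_maxl.
  have h3 := uP n; have h4 := Fs (u n + w); rewrite FD in h4.
  have h5 := rdot_ge0 (w + (v - u n)).
  move: h1 h5; rewrite !(rdotDl, rdotDr, rdotNl, rdotNr).
  rewrite (rdotC v w) (rdotC (u n) w).
  move: h2 h3 h4; move: (F (u n)) (s) (n.+1%:R^-1).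
  move: (rdot w w) (rdot w v) (rdot w (u n)) (rdot v v) (rdot v (u n)).
  move: (rdot (u n) v) (rdot (u n) (u n)) (re (phi w)) => *; lra.
exists v => w; apply/eqP; rewrite -subr_eq0; set c := _ - _.
have cw (e : R) : 0 < e -> re (`|c| ^+ 2) <= e * (re (`|c| ^+ 2) * rdot w w).
  move=> e0; have := key ((e%:C * c^*%C) *: w).
  have -> : re (phi ((e%:C * c^*%C) *: w)) - rdot ((e%:C * c^*%C) *: w) v =
      re (e%:C * `|c| ^+ 2).
    by rewrite /rdot phiZ innerZl -reN -reD sqr_normc /c; congr re; ring.
  have -> : rdot ((e%:C * c^*%C) *: w) ((e%:C * c^*%C) *: w) =
      e ^+ 2 * (re (`|c| ^+ 2) * rdot w w).
    apply: complexI; rewrite rdotZ normrM normcJ exprMn ger0_norm ?ler0c ?ltW //.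
    rewrite [RHS]rmorphM [X in _ = _ * X]rmorphM rmorphXn -mulrA.
    congr (_ * (_ * _)).
    by rewrite [RHS]RRe_real ?rpredX ?normr_real.
  have -> : re (e%:C * `|c| ^+ 2) = e * re (`|c| ^+ 2).
    by rewrite reZ.
  by rewrite expr2 -mulrA ler_pM2l.
have c0 : re (`|c| ^+ 2) <= 0.
  apply/ler_addgt0Pr => e e0; rewrite add0r.
  set t := re _ * _ in cw.
  have [t0|t0] := leP t 0.
    have := cw 1 ltr01; lra.
  have := cw (e / t) (divr_gt0 e0 t0).
  by rewrite divfK // gt_eqF.
have cle0 : `|c| ^+ 2 <= 0.
  by rewrite -[X in X <= _]RRe_real ?rpredX ?normr_real // lecR.
have : `|c| ^+ 2 == 0 by rewrite eq_le cle0 exprn_ge0.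
by rewrite expf_eq0 normr_eq0.
Qed.

End RealPart.

Section Adjoint.
Variables (R : realType) (H K : hilbertType R).

(* The adjoint of T; adjointP shows that the default value 0 is never used
   when T is linear and bounded. *)
Definition adjoint (T : H -> K) (y : K) : H :=
  xget 0 [set x | forall z, inner (T z) y = inner z x].

Lemma adjointP (T : {linear H -> K}) : bounded_near T (nbhs 0) ->
  forall x y, inner (T x) y = inner x (adjoint T y).
Proof.
move=> /linear_boundedP/pinfty_ex_gt0[M M0 TM] x y.
have [m m0 mM] : exists2 m : R, 0 < m & m%:C = M.
  exists (complex.Re M); last by rewrite RRe_real // gtr0_real.
  by move: M0; rewrite ltcE => /andP[].
have Tm z : rdot (T z) (T z) <= m ^+ 2 * rdot z z.
  rewrite -lecR rmorphM rmorphXn /= !rdotE -exprMn mM.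
  by rewrite lerXn2r ?nnegrE ?TM // mulr_ge0 // ltW.
have [v vP] : exists v, forall z, inner (T z) y = inner z v.
  apply: (@riesz _ _ (fun z => inner (T z) y) (m ^+ 2 * rdot y y)).
  - by move=> a b; rewrite linearD linearDl.
  - by move=> c a; rewrite linearZ innerZl.
  move=> z; have := rdot_ge0 (m^-1%:C *: T z - m%:C *: y).
  rewrite !(rdotDl, rdotDr, rdotNl, rdotNr, rdotZl, rdotZr) (rdotC y).
  rewrite -/(rdot (T z) y) !mulrA mulVf ?gt_eqF // mulfV ?gt_eqF // -expr2.
  have : m^-1 * m^-1 * rdot (T z) (T z) <= rdot z z.
    by rewrite -invfM -expr2 ler_pdivrMl ?exprn_gt0.
  rewrite /= ; lra.
by rewrite /adjoint; case: xgetP => [w _ ->|/(_ v)/(_ vP)].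
Qed.

End Adjoint.

(* None is the index oo; Some n is the (n+1)-st index of {1, 2, ...}. *)
Notation natbar := (option nat).
Notation noo := (@None nat).

Record parentSpace (R : realType) (H : natbar -> hilbertType R) := ParentSpace {
  parent :> hilbertType R;
  isom : forall n, {linear H n -> parent};
  isom_isometry : forall n, {mono isom n : x / `|x|}
}.
Arguments isom {R H} p n.

Definition factorises (R : realType) (H : natbar -> hilbertType R)
    (P : parentSpace H)
    (J : forall n : nat, {linear H (Some n) -> H noo}) :=
  forall n, J n =1 adjoint (isom P noo) \o isom P (Some n).

Definition range_proj (R : realType) (H : natbar -> hilbertType R)
    (P : parentSpace H) (n : natbar) : P -> P :=
  isom P n \o adjoint (isom P n).
Arguments range_proj {R H} P n.

Definition projs_commute (R : realType) (H : natbar -> hilbertType R)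
    (P : parentSpace H) :=
  forall n : nat, range_proj P (Some n) \o range_proj P noo =1
                  range_proj P noo \o range_proj P (Some n).

Lemma isom_bounded (R : realType) (H : natbar -> hilbertType R)
    (P : parentSpace H) n : bounded_near (isom P n) (nbhs 0).
Proof.
apply/linear_boundedP; near=> r => x.
by rewrite isom_isometry ler_peMl //; near: r; exact: nbhs_pinfty_ge.
Unshelve. all: by end_near. Qed.

(* Main.v *)
Require Import Defs.
From mathcomp Require Import all_boot all_order all_algebra.
From mathcomp Require Import complex.
From mathcomp Require Import lra.
From mathcomp Require Import all_classical all_reals all_analysis.

Import Order.TTheory GRing.Theory Num.Theory.
Import numFieldNormedType.Exports.
Local Open Scope classical_set_scope.
Local Open Scope ring_scope.

(** The commutation of P_n and P_oo only depends on J_n: it holds if and only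
    if J_n is a partial isometry, i.e. J J^* J = J.  Write p = P_n, q = P_oo.
    If pq = qp then J J^* J = i_oo^* p q i_n = i_oo^* q p i_n = J.  Conversely,
    p q p = i_n J^* J i_n^* is then idempotent, so that X = (1 - p) q p
    satisfies X^* X = p q p - p q p q p = 0.  Hence q p = p q p is self-adjoint,
    that is, q p = p q. *)

Section RealDot.
Context {R : realType}.

Lemma rdot_eq0 {H : hilbertType R} {x : H} : rdot x x = 0 -> x = 0.
Proof.
move=> x0; have /esym/eqP := rdotE x.
by rewrite x0 expf_eq0 normr_eq0 => /eqP.
Qed.

(** The real part of the inner product already separates vectors: [z := x - y] gives |x - y|^2 =
    0. *)
Lemma rdot_inj {H : hilbertType R} {x y : H} :
  (forall z, rdot z x = rdot z y) -> x = y.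
Proof.
move=> xy; apply/eqP; rewrite -subr_eq0; apply/eqP/rdot_eq0.
by rewrite rdotDr rdotNr xy subrr.
Qed.

(* Both [rdot (w - x) (w - x)] and its negative equal [rdot w w - rdot x x],
   where [w := T^* (T x)]. *)
Lemma isometry_adjointK {H K : hilbertType R} {T : {linear H -> K}}
    {T' : K -> H} : {mono T : x / `|x|} ->
  (forall x y, rdot (T x) y = rdot x (T' y)) -> cancel T T'.
Proof.
move=> Tn TT' x; set w := T' (T x).
have Tr z : rdot (T z) (T z) = rdot z z.
  by apply: complexI; rewrite !rdotE Tn.
have xw : rdot x w = rdot x x by rewrite -TT' Tr.
have ww : rdot (T w) (T x) = rdot w w by rewrite TT'.
apply/eqP; rewrite -subr_eq0; apply/eqP/rdot_eq0.
have := Tr (w - x); rewrite linearB !(rdotDl, rdotDr, rdotNl, rdotNr) !Tr.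
by rewrite (rdotC (T x)) (rdotC w x) ww xw; lra.
Qed.

End RealDot.

Section ParentSpace.
Context {R : realType} {H : natbar -> hilbertType R} (P : parentSpace H).

Lemma rdot_isom n x y : rdot (isom P n x) y = rdot x (adjoint (isom P n) y).
Proof. by rewrite /rdot (adjointP (@isom_bounded _ _ P n)). Qed.

Lemma isomK n : cancel (isom P n) (adjoint (isom P n)).
Proof. exact: isometry_adjointK (@isom_isometry _ _ P n) (@rdot_isom n). Qed.

Lemma range_proj_id n x :
  range_proj P n (range_proj P n x) = range_proj P n x.
Proof. by rewrite /range_proj /= isomK. Qed.

Lemma rdot_range_proj n x y :
  rdot (range_proj P n x) y = rdot x (range_proj P n y).
Proof. by rewrite /range_proj /= rdot_isom rdotC -rdot_isom rdotC. Qed.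

(** If P factorises J, then [transition noo (Some n)] is J_n, and swapping the indices gives
    J_n^*. *)
Definition transition (m n : natbar) : H n -> H m :=
  adjoint (isom P m) \o isom P n.

Lemma rdot_transition m n x y :
  rdot (transition m n x) y = rdot x (transition n m y).
Proof. by rewrite /transition /= rdotC -rdot_isom rdotC rdot_isom. Qed.

(** Here m and n stand for n and oo in the overview, and [transition n m] for J_n. *)
Lemma range_proj_commP m n :
  range_proj P m \o range_proj P n =1 range_proj P n \o range_proj P m <->
  (forall x, transition n m (transition m n (transition n m x)) =
             transition n m x).
Proof.
set p := range_proj P m; set q := range_proj P n.
split=> [pq x|JJJ].
  have := congr1 (adjoint (isom P n)) (pq (isom P m x)).
  by rewrite /p /q /range_proj /transition /= !isomK.
(* By conversion, p q p = i_m T^* T i_m^* with T = [transition n m]. *)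
have pqp_id x : p (q (p (q (p x)))) = p (q (p x)).
  exact: (congr1 (isom P m \o transition m n) (JJJ (adjoint (isom P m) x))).
have rp a b : rdot a (p b) = rdot (p a) b by rewrite rdot_range_proj.
have rq a b : rdot a (q b) = rdot (q a) b by rewrite rdot_range_proj.
have pp a : p (p a) = p a by rewrite /p range_proj_id.
have qq a : q (q a) = q a by rewrite /q range_proj_id.
have qp x : q (p x) = p (q (p x)).
  apply/eqP; rewrite -subr_eq0; apply/eqP/rdot_eq0.
  (* Once all projections stand on the left, each of the four terms is plus or minus
     [rdot (p (q (p x))) x], and they cancel. *)
  rewrite rdotDl !rdotDr !rdotNl !rdotNr !(rp, rq) !(pp, qq, pqp_id).
  lra.
move=> x /=; apply: rdot_inj => z.
(* Moving the projections onto [z] leaves q p z = p q p z. *)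
by rewrite qp !(rp, rq) -qp.
Qed.

End ParentSpace.

Theorem corollary2p16 (R : realType) (H : natbar -> hilbertType R)
    (J : forall n : nat, {linear H (Some n) -> H noo})
    (J_bounded : forall n : nat, bounded_near (J n) (nbhs (0 : H (Some n)))) :
  (exists P : parentSpace H, factorises P J /\ projs_commute P) ->
  forall P : parentSpace H, factorises P J -> projs_commute P.
Proof.
move=> [Q [QJ Qcomm]] P PJ n.
have PQ x : transition P noo (Some n) x = transition Q noo (Some n) x.
  by rewrite /transition -PJ -QJ.
(* Adjoints of equal maps agree. *)
have PQ' y : transition P (Some n) noo y = transition Q (Some n) noo y.
  by apply: rdot_inj => z; rewrite -!rdot_transition PQ.
apply/range_proj_commP => x; rewrite !PQ PQ'.
by have /range_proj_commP := Qcomm n; apply.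
Qed.
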